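(* Let $\mathbb{F}$ be a field and $G$ a group. The endomorphism map $$\mathrm{End}:\mathcal{M}_{G,\mathbb{F}}\to\mathrm{Gr}(G,\mathbb{F}),\qquad[W_G]_{\mathrm{eq}}\mapsto[\mathrm{End}^{\mathrm{r}(G)}_{A_G}(W_G)]$$ ($W_G$ a graded left module over a $G$-graded $\mathbb{F}$-algebra $A_G$) is a morphism of pointed $G$-sets.
   Context: Algebras are associative and unital. A $G$-graded $\mathbb{F}$-algebra is $A_G=\bigoplus_{g\in G}A_g$ with $A_gA_h\subseteq A_{gh}$; a $G$-graded left $A_G$-module is $W_G=\bigoplus_gW_g$ with $A_gW_h\subseteq W_{gh}$. $\mathrm{End}^{\mathrm{r}(G)}_{A_G}(W_G)=\bigoplus_g\mathrm{End}^{\mathrm{r}(g)}_{A_G}(W_G)$, where $\mathrm{End}^{\mathrm{r}(g)}_{A_G}(W_G)$ is the set of $A_G$-endomorphisms mapping $W_h$ into $W_{hg}$ for all $h$; it acts from the right (product $\phi\psi$: first $\phi$, then $\psi$) and is a $G$-graded algebra. $\mathrm{Gr}(G,\mathbb{F})=\mathrm{Gr}_{\kappa}(G,\mathbb{F})$ is the set of graded-isomorphism classes $[A_G]$ of $G$-graded $\mathbb{F}$-algebras whose cardinality is bounded by some infinite cardinality $\kappa$, pointed by the class $[\mathbb{F}G]$ of the group algebra. Graded left modules $W_G$ over $A_G$ and $W'_G$ over $A'_G$ are $G$-equivariant if there are a graded (degree-preserving) algebra isomorphism $\psi:A_G\to A'_G$ and a degree-preserving linear isomorphism $\varphi:W_G\to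 W'_G$ with $\varphi(xw)=\psi(x)\varphi(w)$ for all $x\in A_G$, $w\in W_G$. $\mathcal{M}_{G,\mathbb{F}}=\mathcal{M}_{\kappa,\kappa',G,\mathbb{F}}$ is the set of equivariance classes $[W_G]_{\mathrm{eq}}$ of graded left modules, whose cardinalities are bounded by some infinite cardinality $\kappa'$, over $G$-graded $\mathbb{F}$-algebras $A_G$ with $[A_G]\in\mathrm{Gr}_{\kappa}(G,\mathbb{F})$, together with a zero object, which is the class of the zero modules over all $G$-graded $\mathbb{F}$-algebras; it is pointed by the class of $\mathbb{F}G$ as a free module of rank one over itself. $G$ acts on $\mathcal{M}_{G,\mathbb{F}}$ by $h[W_G]_{\mathrm{eq}}=[h(W_G)]_{\mathrm{eq}}$, where the suspension $h(W_G)$ is the same module regraded by $h(W_G)_g:=W_{gh}$. $G$ acts on $\mathrm{Gr}(G,\mathbb{F})$ by $h([A_G])=[\iota_h(A_G)]$, where $\iota_h(A_G)$ is the same algebra with grading $\iota_h(A)_g:=A_{h^{-1}gh}$. A morphism of pointed $G$-sets is a $G$-equivariant map preserving base points.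
   Formalization: The cardinal bounds are made explicit: the group algebra FG has cardinality at most κ and at most κ', and κ'^κ' ≤ κ; the last is necessary for End to land in Gr_κ (for F = ℚ, G trivial, κ = κ' = ℵ₀, the endomorphism algebra of ℚ^(ℕ) is too large). *)

(* Defs.v *)
From HB Require Import structures.
From mathcomp Require Import all_boot all_algebra finmap.
From mathcomp.multinomials Require Import monalg.
From mathcomp Require Import boolp classical_sets functions cardinality.

Set Implicit Arguments.
Unset Strict Implicit.
Unset Printing Implicit Defensive.

Import GRing.Theory.
Local Open Scope classical_set_scope.
Local Open Scope card_scope.
Local Open Scope ring_scope.

(* [algType F] requires [1 != 0]. The endomorphism algebra of a zero module   *)
(* is the zero algebra, so unital algebras are introduced here over           *)
(* [pzRingType], where [1 = 0] is allowed. The mixin carries its own scaling  *)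
(* because a join of [pzRingType] and [lmodType F] cannot be added below the  *)
(* library's [lalgType F]; the [lmodType F] structure is derived from it.     *)
HB.mixin Record isPzAlgebra (F : fieldType) A of GRing.PzRing A := {
  pzscale : F -> A -> A;
  pzscaleA : forall (c d : F) (x : A), pzscale c (pzscale d x) = pzscale (c * d) x;
  pzscale1 : left_id 1 pzscale;
  pzscaleDr : right_distributive pzscale +%R;
  pzscaleDl : forall x : A, {morph pzscale^~ x : c d / c + d};
  pzscaleAl : forall (c : F) (x y : A), pzscale c (x * y) = pzscale c x * y;
  pzscaleAr : forall (c : F) (x y : A), pzscale c (x * y) = x * pzscale c y
}.

#[short(type="pzAlgType")]
HB.structure Definition PzAlgebra (F : fieldType) :=
  {A of GRing.PzRing A & isPzAlgebra F A}.

HB.instance Definition _ (F : fieldType) (A : pzAlgType F) :=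
  GRing.Zmodule_isLmodule.Build F (PzAlgebra.sort A)
    pzscaleA pzscale1 pzscaleDr pzscaleDl.

Lemma pzscalerAl (F : fieldType) (A : pzAlgType F) (c : F) (x y : A) :
  c *: (x * y) = (c *: x) * y.
Proof. exact: pzscaleAl. Qed.

Lemma pzscalerAr (F : fieldType) (A : pzAlgType F) (c : F) (x y : A) :
  c *: (x * y) = x * (c *: y).
Proof. exact: pzscaleAr. Qed.

(* A module over an [F]-algebra [A], seen as an [F]-vector space via          *)
(* [c |-> c *: 1 : F -> A].                                                   *)
Definition res_scalars (F : fieldType) (A : pzAlgType F) (W : lmodType A)
  : Type := W.

Section ResScalars.
Variables (F : fieldType) (A : pzAlgType F) (W : lmodType A).

HB.instance Definition _ := GRing.Zmodule.copy (res_scalars W) W.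

Let scale (c : F) (w : res_scalars W) : res_scalars W :=
  (c *: (1 : A)) *: (w : W).

Let scaleA c d w : scale c (scale d w) = scale (c * d) w.
Proof. by rewrite /scale !scalerA -pzscalerAl mul1r scalerA. Qed.

Let scale1 : left_id 1 scale.
Proof. by move=> w; rewrite /scale !scale1r. Qed.

Let scaleDr : right_distributive scale +%R.
Proof. by move=> c v w; rewrite /scale scalerDr. Qed.

Let scaleDl w : {morph scale^~ w : c d / c + d}.
Proof. by move=> c d; rewrite /scale !scalerDl. Qed.

HB.instance Definition _ :=
  GRing.Zmodule_isLmodule.Build F (res_scalars W) scaleA scale1 scaleDr scaleDl.

Lemma res_scalarsE (c : F) (w : res_scalars W) :
  c *: w = (c *: (1 : A)) *: (w : W).
Proof. by []. Qed.

End ResScalars.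

(* The vector space [V] is the internal direct sum of the subspaces [V_ g].   *)
Record is_grading (F : fieldType) (G : groupType) (V : lmodType F)
    (V_ : G -> set V) : Prop := IsGrading {
  grading0 : forall g, V_ g 0;
  gradingP : forall g (c : F) u v, V_ g u -> V_ g v -> V_ g (c *: u + v);
  grading_span : forall v, exists (s : seq G) (u : G -> V),
    (forall g, V_ g (u g)) /\ v = \sum_(g <- s) u g;
  grading_indep : forall (s : seq G) (u : G -> V), uniq s ->
    (forall g, V_ g (u g)) -> \sum_(g <- s) u g = 0 ->
    forall g, g \in s -> u g = 0
}.

Record galg (F : fieldType) (G : groupType) := GAlg {
  ga_sort :> pzAlgType F;
  ga_comp : G -> set ga_sort;
  ga_grading : is_grading ga_comp;
  ga_mul : forall g h x y,
    ga_comp g x -> ga_comp h y -> ga_comp (g * h)%g (x * y)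
}.
Arguments ga_comp {F G} A g : rename.

Record gmod (F : fieldType) (G : groupType) := GMod {
  gm_alg : galg F G;
  gm_sort :> lmodType gm_alg;
  gm_comp : G -> set gm_sort;
  gm_grading : @is_grading F G (res_scalars gm_sort) gm_comp;
  gm_act : forall g h x w,
    ga_comp gm_alg g x -> gm_comp h w -> gm_comp (g * h)%g (x *: w)
}.
Arguments gm_comp {F G} W g : rename.

Definition galg_morph (F : fieldType) (G : groupType) (A B : galg F G)
    (f : A -> B) : Prop :=
  [/\ linear f, GRing.monoid_morphism f &
      forall g x, ga_comp A g x -> ga_comp B g (f x)].

Definition galg_iso (F : fieldType) (G : groupType) (A B : galg F G)
    (f : A -> B) : Prop := galg_morph f /\ bijective f.

Definition galg_isog (F : fieldType) (G : groupType) (A B : galg F G) : Prop :=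
  exists f : A -> B, galg_iso f.

Definition gmod_equivariant (F : fieldType) (G : groupType) (W V : gmod F G)
    : Prop :=
  exists (psi : gm_alg W -> gm_alg V) (phi : W -> V),
    [/\ galg_iso psi,
        linear (phi : res_scalars W -> res_scalars V) /\ bijective phi,
        forall g w, gm_comp W g w -> gm_comp V g (phi w) &
        forall x w, phi (x *: w) = psi x *: phi w].

Definition gmod_zero (F : fieldType) (G : groupType) (W : gmod F G) : Prop :=
  forall w : W, w = 0.

(* The zero modules over all graded algebras form a single class.             *)
Definition gmod_eqv (F : fieldType) (G : groupType) (W V : gmod F G) : Prop :=
  gmod_equivariant W V \/ (gmod_zero W /\ gmod_zero V).


Section GradingTheory.
Variables (F : fieldType) (G : groupType).

Lemma gradingD (V : lmodType F) (V_ : G -> set V) (gr : is_grading V_) g u v :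
  V_ g u -> V_ g v -> V_ g (u + v).
Proof. by move=> ug vg; rewrite -[u]scale1r; apply: gradingP. Qed.

Lemma gradingMn (V : lmodType F) (V_ : G -> set V) (gr : is_grading V_) g u n :
  V_ g u -> V_ g (u *+ n).
Proof.
move=> ug; elim: n => [|n IHn]; first by rewrite mulr0n; apply: grading0.
by rewrite mulrS; apply: gradingD.
Qed.

Lemma gradingN (V : lmodType F) (V_ : G -> set V) (gr : is_grading V_) g u :
  V_ g u -> V_ g (- u).
Proof.
by move=> ug; rewrite -[- u]addr0 -scaleN1r; apply: gradingP => //; apply: grading0.
Qed.

Lemma sum_undup (V : zmodType) (s : seq G) (u : G -> V) :
  \sum_(g <- s) u g = \sum_(g <- undup s) u g *+ count_mem g s.
Proof.
rewrite -big_undup_iterop_count /=; apply: eq_bigr => g _.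
by case: (count _ s) => // n; rewrite -Monoid.iteropE /=; elim: n => //= n IHn.
Qed.

Lemma sum_pad (V : zmodType) (s r : seq G) (u : G -> V) :
  uniq r -> {subset s <= r} ->
  \sum_(g <- s) u g = \sum_(g <- r) u g *+ count_mem g s.
Proof.
move=> ru sr; rewrite sum_undup.
rewrite [RHS](bigID (mem s)) /= [X in _ = _ + X]big1 ?addr0; last first.
  by move=> g /count_memPn ->.
rewrite -[RHS]big_filter; apply: perm_big; apply: uniq_perm.
- exact: undup_uniq.
- exact: filter_uniq.
- move=> g; rewrite mem_undup mem_filter /=.
  by case: (boolP (g \in s)) => // /sr ->.
Qed.

Lemma grading_span_uniq (V : lmodType F) (V_ : G -> set V)
    (gr : is_grading V_) v :
  exists (s : seq G) (u : G -> V),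
    [/\ uniq s, forall g, V_ g (u g) & v = \sum_(g <- s) u g].
Proof.
have [s [u [uP ->]]] := grading_span gr v.
exists (undup s), (fun g => u g *+ count_mem g s).
by split; [exact: undup_uniq | move=> g; exact: gradingMn | exact: sum_undup].
Qed.

(* A degree-preserving linear map reflects degrees if it is injective.        *)
Lemma grading_reflect (V W : lmodType F) (V_ : G -> set V) (W_ : G -> set W)
    (f : V -> W) (grV : is_grading V_) (grW : is_grading W_) :
  linear f -> injective f -> (forall g v, V_ g v -> W_ g (f v)) ->
  forall g v, W_ g (f v) -> V_ g v.
Proof.
move=> fL fI fV g v Wfv.
have f0 : f 0 = 0 by have := fL (-1) 0 0; rewrite scaler0 addr0 scaleN1r addNr.
have fD x y : f (x + y) = f x + f y by have := fL 1 x y; rewrite !scale1r.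
have fS s (u : G -> V) : f (\sum_(h <- s) u h) = \sum_(h <- s) f (u h).
  exact: (big_morph f fD f0).
have [s [u [us uV vE]]] := grading_span_uniq grV v.
pose u' h := if h == g then u g - v else u h.
pose fu' h := if h == g then (if g \in s then f (u g) else 0) - f v else f (u h).
have gN w : W_ g w -> W_ g (w - f v).
  by move=> Ww; apply: gradingD => //; apply: gradingN.
have fu'W h : W_ h (fu' h).
  rewrite /fu'; case: eqP => [->|_]; last exact: fV.
  by apply: gN; case: ifP => _; [exact: fV | exact: grading0].
pose s' := g :: rem g s.
have s'u : uniq s' by rewrite /s' /= mem_rem_uniqF ?rem_uniq.
have sum0 : \sum_(h <- s') fu' h = 0.
  rewrite /s' big_cons {1}/fu' eqxx.
  rewrite (eq_big_seq (fun h => f (u h))); last first.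
    move=> h hs; rewrite /fu'; case: eqP => // hg.
    by move: hs; rewrite hg mem_rem_uniqF.
  rewrite addrAC; apply/eqP; rewrite subr_eq0 vE fS; apply/eqP.
  case: ifP => gs; first by rewrite [RHS](perm_big _ (perm_to_rem gs)) big_cons.
  by rewrite add0r rem_id ?gs.
have := grading_indep grW s'u fu'W sum0 (mem_head _ _).
rewrite /fu' eqxx => /eqP; rewrite subr_eq0; case: ifP => _ /eqP.
  by move=> /fI <-.
by rewrite -f0 => /fI <-; apply: grading0.
Qed.

Lemma grading_reindex (V : lmodType F) (V_ : G -> set V) (s t : G -> G) :
  cancel s t -> cancel t s -> is_grading V_ -> is_grading (fun g => V_ (s g)).
Proof.
move=> sK tK gr; split.
- by move=> g; apply: grading0.
- by move=> g c u v; apply: gradingP.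
- move=> v; have [r [u [uV ->]]] := grading_span gr v.
  exists (map t r), (fun g => u (s g)); split => //.
  by rewrite big_map; apply: eq_bigr => g _; rewrite tK.
- move=> r u ru uV sum0 g gr'; rewrite -[g]sK.
  have := @grading_indep _ _ _ _ gr (map s r) (u \o t) _ _ _ (s g).
  apply.
  + by rewrite map_inj_uniq //; exact: can_inj sK.
  + by move=> h /=; rewrite -{1}[h]tK; apply: uV.
  + by rewrite big_map -[RHS]sum0; apply: eq_bigr => h _ /=; rewrite sK.
  + exact: map_f.
Qed.

Implicit Types (A B C : galg F G) (U V W : gmod F G).

Lemma can_linear (V W : lmodType F) (f : V -> W) (f' : W -> V) :
  linear f -> cancel f f' -> cancel f' f -> linear f'.
Proof.
move=> fL fK f'K c x y; apply: (can_inj fK).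
by rewrite fL !f'K.
Qed.

Lemma galg_iso_id A : galg_iso (id : A -> A).
Proof. by split; [split | exists id]. Qed.

Lemma galg_iso_can A B (f : A -> B) (f' : B -> A) :
  galg_morph f -> cancel f f' -> cancel f' f -> galg_iso f'.
Proof.
move=> [fL [f1 fM] fD] fK f'K; split; last by exists f.
split; first exact: can_linear fL fK f'K.
  split; first by rewrite -f1 fK.
  by move=> x y; apply: (can_inj fK); rewrite fM !f'K.
move=> g x Bx.
apply: (grading_reflect (ga_grading A) (ga_grading B) fL (can_inj fK) fD).
by rewrite f'K.
Qed.

Lemma galg_iso_comp A B C (f : A -> B) (k : B -> C) :
  galg_iso f -> galg_iso k -> galg_iso (k \o f).
Proof.
move=> [[fL [f1 fM] fD] fb] [[kL [k1 kM] kD] kb]; split; last exact: bij_comp.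
split; first by move=> c x y /=; rewrite fL kL.
  by split; [rewrite /= f1 k1 | move=> x y /=; rewrite fM kM].
by move=> g x Ax; apply/kD/fD.
Qed.

Lemma galg_isog_refl A : galg_isog A A.
Proof. by exists id; exact: galg_iso_id. Qed.

Lemma galg_isog_sym A B : galg_isog A B -> galg_isog B A.
Proof.
by move=> [f [fM [f' fK f'K]]]; exists f'; exact: galg_iso_can fM fK f'K.
Qed.

Lemma galg_isog_trans A B C : galg_isog A B -> galg_isog B C -> galg_isog A C.
Proof. by move=> [f fI] [k kI]; exists (k \o f); exact: galg_iso_comp. Qed.

Lemma gmod_equivariant_refl W : gmod_equivariant W W.
Proof.
exists id, id; split => //; first exact: galg_iso_id.
by split => //; exists id.
Qed.

Lemma gmod_equivariant_sym U V : gmod_equivariant U V -> gmod_equivariant V U.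
Proof.
move=> [psi [phi [[psiM [psi' psiK psi'K]] [phiL [phi' phiK phi'K]] phiD phiA]]].
have phi'L := @can_linear (res_scalars U) (res_scalars V) _ _ phiL phiK phi'K.
exists psi', phi'; split.
- exact: galg_iso_can psiM psiK psi'K.
- by split => //; exists phi.
- move=> g w Vw.
  apply: (@grading_reflect (res_scalars U) (res_scalars V) _ _ phi
    (gm_grading U) (gm_grading V) phiL (can_inj phiK) phiD).
  by rewrite phi'K.
- by move=> x w; apply: (can_inj phiK); rewrite phiA psi'K !phi'K.
Qed.

Lemma gmod_equivariant_trans U V W :
  gmod_equivariant U V -> gmod_equivariant V W -> gmod_equivariant U W.
Proof.
move=> [p [f [pI [fL fb] fD fA]]] [q [k [qI [kL kb] kD kA]]].
exists (q \o p), (k \o f); split; first exact: galg_iso_comp.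
- by split; [move=> c x y /=; rewrite fL kL | exact: bij_comp].
- by move=> g w Uw; apply/kD/fD.
- by move=> x w; rewrite /= fA kA.
Qed.

Lemma gmod_equivariant_zero U V :
  gmod_equivariant U V -> gmod_zero U -> gmod_zero V.
Proof.
move=> [p [f [_ [fL [f' fK f'K]] _ _]]] U0 w.
have f'L := @can_linear (res_scalars U) (res_scalars V) _ _ fL fK f'K.
by rewrite -[w]f'K -[RHS]f'K (U0 (f' w)) (U0 (f' 0)).
Qed.

Lemma gmod_eqv_refl W : gmod_eqv W W.
Proof. by left; exact: gmod_equivariant_refl. Qed.

Lemma gmod_eqv_sym U V : gmod_eqv U V -> gmod_eqv V U.
Proof. by move=> [/gmod_equivariant_sym|[]]; [left | right]. Qed.

Lemma gmod_eqv_trans U V W : gmod_eqv U V -> gmod_eqv V W -> gmod_eqv U W.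
Proof.
move=> [UV|[U0 V0]] [VW|[V0' W0]].
- by left; exact: gmod_equivariant_trans UV VW.
- right; split => //; apply: gmod_equivariant_zero V0'.
  exact: gmod_equivariant_sym.
- by right; split => //; apply: gmod_equivariant_zero VW V0.
- by right.
Qed.

End GradingTheory.

Section Regrade.
Variables (F : fieldType) (G : groupType).

Section Iota.
Variables (h : G) (A : galg F G).

Let comp (g : G) : set A := ga_comp A (h^-1 * g * h)%g.

Let grading_comp : is_grading comp.
Proof.
apply: (grading_reindex (t := fun g => (h * g * h^-1)%g) _ _ (ga_grading A)).
- by move=> g; rewrite !mulgA mulgV mul1g mulgK.
- by move=> g; rewrite !mulgA mulVg mul1g mulgVK.
Qed.

Let compM g k x y : comp g x -> comp k y -> comp (g * k)%g (x * y).
Proof.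
rewrite /comp; have -> : (h^-1 * (g * k) * h = (h^-1 * g * h) * (h^-1 * k * h))%g.
  by rewrite !mulgA mulgK.
exact: ga_mul.
Qed.

Definition iota_galg : galg F G := GAlg grading_comp compM.

End Iota.

Section Suspension.
Variables (h : G) (W : gmod F G).

Let comp (g : G) : set W := gm_comp W (g * h)%g.

Let grading_comp : @is_grading F G (res_scalars W) comp.
Proof.
apply: (grading_reindex (t := fun g => (g * h^-1)%g) _ _ (gm_grading W)).
- by move=> g; rewrite mulgK.
- by move=> g; rewrite mulgVK.
Qed.

Let compA g k x w : ga_comp (gm_alg W) g x -> comp k w -> comp (g * k)%g (x *: w).
Proof. by rewrite /comp -mulgA; apply: gm_act. Qed.

Definition suspension : gmod F G := GMod grading_comp compA.

End Suspension.

End Regrade.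

Section EndR.
Variables (F : fieldType) (G : groupType) (W : gmod F G).

(* [f] is an [A_G]-endomorphism of [W_G] mapping [W_h] into [W_hg].           *)
Definition end_hom (g : G) (f : W -> W) : Prop :=
  linear f /\ forall h w, gm_comp W h w -> gm_comp W (h * g)%g (f w).

Definition end_pred (f : W -> res_scalars W) : Prop :=
  exists (s : seq G) (u : G -> W -> res_scalars W),
    (forall g, end_hom g (u g)) /\ f = \sum_(g <- s) u g.

Definition end_mem : {pred W -> res_scalars W} := [pred f | `[< end_pred f >]].

Lemma end_memP f : reflect (end_pred f) (f \in end_mem).
Proof. exact: asboolP. Qed.

Lemma res_scalarsC (f : W -> W) (c : F) (w : W) : linear f ->
  f ((c *: (1 : gm_alg W)) *: w) = (c *: (1 : gm_alg W)) *: f w.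
Proof.
move=> fL; have f0 : f 0 = 0.
  by have := fL (-1) 0 0; rewrite scaler0 addr0 scaleN1r addNr.
by have := fL (c *: (1 : gm_alg W)) w 0; rewrite !addr0 f0 addr0.
Qed.

Lemma end_hom0 g : end_hom g (0 : W -> res_scalars W).
Proof.
split; first by move=> a u v /=; rewrite scaler0 addr0.
by move=> h w _; apply: (grading0 (gm_grading W)).
Qed.

Lemma end_homP g (c : F) (u v : W -> res_scalars W) :
  end_hom g u -> end_hom g v -> end_hom g (c *: u + v).
Proof.
move=> [uL uD] [vL vD]; split.
  move=> a x y; rewrite !fctE /= uL vL.
  have cE : c *: (a *: u x + u y : res_scalars W)
      = (a *: (c *: u x : W) : res_scalars W) + c *: u y.
    rewrite scalerDr; congr (_ + _).
    by rewrite !res_scalarsE !scalerA -pzscalerAl mul1r -pzscalerAr mulr1.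
  by rewrite cE addrACA; congr (_ + _); rewrite [RHS]scalerDr.
move=> h w Ww; apply: (gradingP (gm_grading W)); [exact: uD | exact: vD].
Qed.

Lemma end_mem_hom g (u : W -> res_scalars W) : end_hom g u -> u \in end_mem.
Proof.
move=> uH; apply/end_memP; exists [:: g], (fun h => if h == g then u else 0).
split; last by rewrite big_seq1 eqxx.
by move=> h; case: eqP => [->//|_]; exact: end_hom0.
Qed.

Lemma end_mem_submod : submod_closed end_mem.
Proof.
split; first by apply: (@end_mem_hom 1%g); exact: end_hom0.
have homMn g (u : W -> res_scalars W) n : end_hom g u -> end_hom g (u *+ n).
  move=> uH; elim: n => [|n IHn]; first exact: end_hom0.
  by rewrite mulrS -[X in X + _]scale1r; apply: end_homP.
move=> c _ _ /end_memP[s [u [uH ->]]] /end_memP[r [v [vH ->]]].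
apply/end_memP; exists (undup (s ++ r)).
exists (fun g => c *: (u g *+ count_mem g s) + v g *+ count_mem g r).
split; first by move=> g; apply: end_homP; apply: homMn.
rewrite big_split /= -scaler_sumr; congr (_ *: _ + _).
  by apply: sum_pad; rewrite ?undup_uniq // => g gs; rewrite mem_undup mem_cat gs.
by apply: sum_pad; rewrite ?undup_uniq // => g gs; rewrite mem_undup mem_cat gs orbT.
Qed.

HB.instance Definition _ :=
  GRing.isSubmodClosed.Build F (W -> res_scalars W) end_mem end_mem_submod.

Lemma end_mem_linear f : f \in end_mem -> linear (f : W -> W).
Proof.
move=> /end_memP[s [u [uH ->]]] a x y.
rewrite !fct_sumE scaler_sumr -big_split /=.
by apply: eq_bigr => g _; case: (uH g) => uL _; rewrite uL.
Qed.

Lemma end_mem1 : (id : W -> res_scalars W) \in end_mem.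
Proof. by apply: (@end_mem_hom 1%g); split => // h w; rewrite mulg1. Qed.

Lemma end_mem_comp (f g : W -> res_scalars W) :
  f \in end_mem -> g \in end_mem -> (g \o f : W -> res_scalars W) \in end_mem.
Proof.
move=> /end_memP[s [u [uH ->]]] gE; have gL := end_mem_linear gE.
have g0 : g 0 = 0.
  by have := gL (-1) 0 0; rewrite scaler0 addr0 scaleN1r addNr.
have gD x y : g (x + y) = g x + g y by have := gL 1 x y; rewrite !scale1r.
have -> : g \o (\sum_(h <- s) u h) = \sum_(h <- s) (g \o u h).
  apply/funext => w /=; rewrite !fct_sumE.
  exact: (big_morph g gD g0).
apply: rpred_sum => h _.
case/end_memP: gE => r [v [vH ->]].
have -> : (\sum_(k <- r) v k) \o u h = \sum_(k <- r) (v k \o u h).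
  by apply/funext => w /=; rewrite !fct_sumE.
apply: rpred_sum => k _; apply: (@end_mem_hom (h * k)%g).
have [[uL uD] [vL vD]] := (uH h, vH k).
split; first by move=> a x y /=; rewrite uL vL.
by move=> l w Ww; rewrite mulgA; apply/vD/uD.
Qed.

(* The carrier of [End^{r(G)}_{A_G}(W_G)].                                    *)
Record endr := EndR {
  endr_fun :> W -> res_scalars W;
  endr_prop : endr_fun \in end_mem
}.

HB.instance Definition _ := [isSub for endr_fun].
HB.instance Definition _ := [Choice of endr by <:].
HB.instance Definition _ := [SubChoice_isSubLmodule of endr by <:].

Implicit Types f k l : endr.

Definition endr1 : endr := EndR end_mem1.

(* Endomorphisms act from the right: in [f * k], [f] is applied first.        *)
Definition endr_mul f k : endr :=
  EndR (end_mem_comp (endr_prop f) (endr_prop k)).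

Lemma endr_linear f : linear (f : W -> W).
Proof. exact: end_mem_linear (endr_prop f). Qed.

Lemma endr0 f : f 0 = 0.
Proof.
by have := endr_linear f (-1) 0 0; rewrite scaler0 addr0 scaleN1r addNr.
Qed.

Lemma endrD f (v w : W) : f (v + w) = f v + f w.
Proof. by have := endr_linear f 1 v w; rewrite !scale1r. Qed.

Lemma endr_ext f k : (forall w, f w = k w) -> f = k.
Proof. by move=> fk; apply/val_inj/funext. Qed.

Lemma endr_sumE (I : Type) (s : seq I) (u : I -> endr) w :
  (\sum_(i <- s) u i : endr) w = \sum_(i <- s) u i w.
Proof. exact: (big_morph (fun f : endr => f w)). Qed.

Let endr_mulA : associative endr_mul.
Proof. by move=> f k l; apply: endr_ext. Qed.

Let endr_mul1r : left_id endr1 endr_mul.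
Proof. by move=> f; apply: endr_ext. Qed.

Let endr_mulr1 : right_id endr1 endr_mul.
Proof. by move=> f; apply: endr_ext. Qed.

Let endr_mulDl : left_distributive endr_mul +%R.
Proof. by move=> f k l; apply: endr_ext => w /=; exact: endrD. Qed.

Let endr_mulDr : right_distributive endr_mul +%R.
Proof. by move=> f k l; apply: endr_ext. Qed.

HB.instance Definition _ := GRing.Zmodule_isPzRing.Build endr
  endr_mulA endr_mul1r endr_mulr1 endr_mulDl endr_mulDr.

Let endr_scaleAl (c : F) (f k : endr) : c *: (f * k) = (c *: f) * k.
Proof.
apply: endr_ext => w /=; apply/esym.
exact: (res_scalarsC c (f w) (endr_linear k)).
Qed.

Let endr_scaleAr (c : F) (f k : endr) : c *: (f * k) = f * (c *: k).
Proof. by apply: endr_ext. Qed.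

HB.instance Definition _ := isPzAlgebra.Build F endr
  (@scalerA F endr) (@scale1r F endr) (@scalerDr F endr)
  (fun x => scalerDl x) endr_scaleAl endr_scaleAr.

Definition endr_comp (g : G) : set endr := [set f : endr | end_hom g f].

Lemma endr_grading : @is_grading F G (endr : pzAlgType F) endr_comp.
Proof.
split.
- by move=> g; exact: end_hom0.
- by move=> g c u v; exact: end_homP.
- move=> [f fE]; have /end_memP[s [u [uH fS]]] := fE.
  exists s, (fun g => EndR (end_mem_hom (uH g))); split => // .
  apply: endr_ext => w; rewrite endr_sumE /=.
  by rewrite fS fct_sumE.
- move=> s u su uH sum0 g gs; apply: endr_ext => w.
  have [r [x [xW ->]]] := grading_span (gm_grading W) w.
  have uD h := big_morph (u h) (endrD (u h)) (endr0 (u h)).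
  rewrite uD; apply: big1 => h _.
  pose y (z : G) := u (h^-1 * z)%g (x h).
  have := @grading_indep _ _ _ _ (gm_grading W)
    (map (fun z : G => h * z)%g s) y _ _ _ (h * g)%g.
  rewrite /y mulKg; apply.
  + by rewrite map_inj_uniq //; exact: mulgI.
  + by move=> z; have [_ /(_ h _ (xW h))] := uH (h^-1 * z)%g; rewrite mulVKg.
  + rewrite big_map; under eq_bigr => z _ do rewrite mulKg.
    have := congr1 (fun f : endr => f (x h)) sum0.
    by rewrite endr_sumE.
  + exact: map_f.
Qed.

Lemma endr_compM g h (f k : endr) :
  endr_comp g f -> endr_comp h k -> endr_comp (g * h)%g (f * k).
Proof.
move=> [_ fD] [_ kD]; split; first exact: endr_linear.
by move=> l w Ww; rewrite mulgA; apply/kD/fD.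
Qed.

End EndR.

(* The graded algebra [End^{r(G)}_{A_G}(W_G)].                                *)
Definition endr_galg (F : fieldType) (G : groupType) (W : gmod F G) : galg F G :=
  GAlg (endr_grading W) (@endr_compM F G W).

Definition group_alg (F : fieldType) (G : groupType) : Type := {malg F[G]}.

Section GroupAlgebra.
Variables (F : fieldType) (G : groupType).

HB.instance Definition _ := GRing.Lmodule.on (group_alg F G).

Implicit Types x y z : group_alg F G.

Definition grpa_mulr x y : group_alg F G :=
  \sum_(k <- msupp x) \sum_(l <- msupp y) << x@_k * y@_l *g (k * l)%g >>.

Definition grpa_one : group_alg F G := << 1 *g (1 : G)%g >>.

Lemma grpa_mulEw (d e : {fset G}) x y :
  (msupp x `<=` d)%fset -> (msupp y `<=` e)%fset ->
  grpa_mulr x y = \sum_(k <- d) \sum_(l <- e) << x@_k * y@_l *g (k * l)%g >>.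
Proof.
move=> xd ye; rewrite /grpa_mulr (big_fset_incl _ xd) /=.
  apply: eq_bigr => k _; apply: big_fset_incl => // l _ /mcoeff_outdom ->.
  by rewrite mulr0 monalgU0.
move=> k _ /mcoeff_outdom xk.
by rewrite big1 // => l _; rewrite xk mul0r monalgU0.
Qed.

Lemma grpa_mulUU (c d : F) (k l : G) :
  grpa_mulr << c *g k >> << d *g l >> = << c * d *g (k * l)%g >>.
Proof. by rewrite (grpa_mulEw msuppU_le msuppU_le) !big_seq_fset1 !mcoeffUU. Qed.

Lemma grpa_mulDl : left_distributive grpa_mulr +%R.
Proof.
move=> x y z; rewrite [grpa_mulr x z](grpa_mulEw (fsubsetUl _ (msupp y)) (fsubset_refl _)).
rewrite [grpa_mulr y z](grpa_mulEw (fsubsetUr (msupp x) _) (fsubset_refl _)).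
rewrite (grpa_mulEw (msuppD_le _ _) (fsubset_refl _)) -big_split /=.
apply: eq_bigr => k _; rewrite -big_split /=; apply: eq_bigr => l _.
by rewrite mcoeffD mulrDl monalgUD.
Qed.

Lemma grpa_mulDr : right_distributive grpa_mulr +%R.
Proof.
move=> x y z; rewrite [grpa_mulr x y](grpa_mulEw (fsubset_refl _) (fsubsetUl _ (msupp z))).
rewrite [grpa_mulr x z](grpa_mulEw (fsubset_refl _) (fsubsetUr (msupp y) _)).
rewrite (grpa_mulEw (fsubset_refl _) (msuppD_le _ _)) -big_split /=.
apply: eq_bigr => k _; rewrite -big_split /=; apply: eq_bigr => l _.
by rewrite mcoeffD mulrDr monalgUD.
Qed.

Lemma grpa_mul0r : left_zero 0 grpa_mulr.
Proof. by move=> x; rewrite /grpa_mulr msupp0 big_seq_fset0. Qed.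

Lemma grpa_mulr0 : right_zero 0 grpa_mulr.
Proof.
by move=> x; rewrite /grpa_mulr big1 // => k _; rewrite msupp0 big_seq_fset0.
Qed.

Lemma grpa_ind (P : group_alg F G -> Prop) :
  P 0 -> (forall x y, P x -> P y -> P (x + y)) ->
  (forall (c : F) (k : G), P << c *g k >>) -> forall x, P x.
Proof. by move=> P0 PD PU x; rewrite [x]monalgE; apply: big_ind. Qed.

Lemma grpa_mulA : associative grpa_mulr.
Proof.
move=> x y z; elim/grpa_ind: x => [|x x' IHx IHx'|c k].
- by rewrite !grpa_mul0r.
- by rewrite !grpa_mulDl IHx IHx'.
elim/grpa_ind: y => [|y y' IHy IHy'|d l].
- by rewrite grpa_mul0r grpa_mulr0 grpa_mul0r.
- by rewrite grpa_mulDl !grpa_mulDr grpa_mulDl IHy IHy'.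
elim/grpa_ind: z => [|z z' IHz IHz'|e m].
- by rewrite !grpa_mulr0.
- by rewrite !grpa_mulDr IHz IHz'.
by rewrite !grpa_mulUU mulrA mulgA.
Qed.

Lemma grpa_mul1r : left_id grpa_one grpa_mulr.
Proof.
elim/grpa_ind => [|x y IHx IHy|c k]; first by rewrite grpa_mulr0.
  by rewrite grpa_mulDr IHx IHy.
by rewrite grpa_mulUU mul1r mul1g.
Qed.

Lemma grpa_mulr1 : right_id grpa_one grpa_mulr.
Proof.
elim/grpa_ind => [|x y IHx IHy|c k]; first by rewrite grpa_mul0r.
  by rewrite grpa_mulDl IHx IHy.
by rewrite grpa_mulUU mulr1 mulg1.
Qed.

HB.instance Definition _ := GRing.Zmodule_isPzRing.Build (group_alg F G)
  grpa_mulA grpa_mul1r grpa_mulr1 grpa_mulDl grpa_mulDr.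

Lemma grpa_scaleU (c d : F) (k : G) :
  c *: (<< d *g k >> : group_alg F G) = << c * d *g k >>.
Proof. by apply/malgP => l; rewrite mcoeffZ !mcoeffU mulrnAr. Qed.

Let grpa_mulrUU (c d : F) (k l : G) :
  (<< c *g k >> : group_alg F G) * (<< d *g l >> : group_alg F G)
    = << c * d *g (k * l)%g >>.
Proof. exact: grpa_mulUU. Qed.

Let grpa_scaleAl (c : F) x y : c *: (x * y) = (c *: x) * y.
Proof.
elim/grpa_ind: x => [|x x' IHx IHx'|d k]; first by rewrite scaler0 !mul0r scaler0.
  by rewrite mulrDl !scalerDr mulrDl IHx IHx'.
elim/grpa_ind: y => [|y y' IHy IHy'|e l]; first by rewrite !mulr0 scaler0.
  by rewrite !mulrDr scalerDr IHy IHy'.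
by rewrite grpa_scaleU !grpa_mulrUU grpa_scaleU mulrA.
Qed.

Let grpa_scaleAr (c : F) x y : c *: (x * y) = x * (c *: y).
Proof.
elim/grpa_ind: x => [|x x' IHx IHx'|d k]; first by rewrite !mul0r scaler0.
  by rewrite !mulrDl scalerDr IHx IHx'.
elim/grpa_ind: y => [|y y' IHy IHy'|e l]; first by rewrite scaler0 !mulr0 scaler0.
  by rewrite mulrDr !scalerDr mulrDr IHy IHy'.
by rewrite grpa_scaleU !grpa_mulrUU grpa_scaleU mulrCA.
Qed.

HB.instance Definition _ := isPzAlgebra.Build F (group_alg F G)
  (@scalerA F (group_alg F G)) (@scale1r F (group_alg F G))
  (@scalerDr F (group_alg F G)) (fun x => scalerDl x) grpa_scaleAl grpa_scaleAr.

(* [(FG)_g = F g]                                                             *)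
Definition grpa_hom (g : G) : set (group_alg F G) := [set << c *g g >> | c in setT].

Lemma grpa_hom_grading : @is_grading F G (group_alg F G : pzAlgType F) grpa_hom.
Proof.
split.
- by move=> g; exists 0 => //; rewrite monalgU0.
- move=> g c _ _ [a _ <-] [b _ <-]; exists (c * a + b) => //.
  rewrite monalgUD; congr (_ + _); exact/esym/grpa_scaleU.
- move=> x; exists (msupp x), (fun g => << x@_g *g g >>).
  by split; [move=> g; exists x@_g | exact: monalgE].
- move=> s u su uH /(congr1 (mcoeff _)) sum0 g gs.
  have [c _ uE] := uH g; have := sum0 g.
  rewrite mcoeff0 (raddf_sum (mcoeff g)) (bigD1_seq g) //= big1 ?addr0; last first.
    by move=> h /negbTE hg; have [d _ <-] := uH h; rewrite mcoeffU hg.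
  by rewrite -uE mcoeffUU => ->; rewrite monalgU0.
Qed.

Lemma grpa_homM g h x y : grpa_hom g x -> grpa_hom h y -> grpa_hom (g * h)%g (x * y).
Proof.
by move=> [c _ <-] [d _ <-]; exists (c * d) => //; rewrite -grpa_mulUU.
Qed.

Definition group_galg : galg F G := GAlg grpa_hom_grading grpa_homM.

Definition grpa_regular : lmodType group_galg := (group_alg F G : pzRingType)^o.

Lemma grpa_regular_grading : @is_grading F G (res_scalars grpa_regular) grpa_hom.
Proof.
have [h0 hP hs hi] := grpa_hom_grading; split => //.
move=> g c u v uH vH; rewrite res_scalarsE.
have -> : (c *: (1 : group_galg)) *: (u : grpa_regular) = c *: (u : group_alg F G).
  by apply: etrans (esym (grpa_scaleAl c 1 u)) _; rewrite mul1r.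
exact: hP.
Qed.

(* [FG] as a free module of rank one over itself                              *)
Definition group_gmod : gmod F G :=
  @GMod F G group_galg grpa_regular grpa_hom grpa_regular_grading grpa_homM.

End GroupAlgebra.

(* A [G]-set with a distinguished element fixed by [G].                       *)
Record pointedGSet (G : groupType) := PointedGSet {
  pgs_sort :> Type;
  pgs_act : G -> pgs_sort -> pgs_sort;
  pgs_base : pgs_sort;
  pgs_act1 : forall x, pgs_act 1%g x = x;
  pgs_actM : forall h k x, pgs_act (h * k)%g x = pgs_act h (pgs_act k x);
  pgs_act_base : forall h, pgs_act h pgs_base = pgs_base
}.
Arguments pgs_base {G} p.

Definition pgs_morphism (G : groupType) (X Y : pointedGSet G) (f : X -> Y)
    : Prop :=
  (forall h x, f (pgs_act h x) = pgs_act h (f x)) /\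
  f (pgs_base X) = pgs_base Y.

(* The [R]-classes [R x] of the objects [x] satisfying [P]. An [R]-class is   *)
(* taken over all of [T], so it may also contain objects outside [P].         *)
Section Classes.
Variables (T : Type) (P : T -> Prop) (R : T -> T -> Prop).
Hypotheses (R_refl : forall x, R x x) (R_sym : forall x y, R x y -> R y x)
  (R_trans : forall x y z, R x y -> R y z -> R x z).

Definition classes : Type := {C : T -> Prop | exists x, P x /\ C = R x}.

Definition class_of (x : T) (Px : P x) : classes :=
  exist _ (R x) (ex_intro _ x (conj Px erefl)).

Definition class_repr (C : classes) : T := sval (cid (svalP C)).

Lemma class_reprP (C : classes) : P (class_repr C).
Proof. by case: (svalP (cid (svalP C))). Qed.

Lemma class_reprE (C : classes) : sval C = R (class_repr C).
Proof. by case: (svalP (cid (svalP C))). Qed.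

Lemma classes_eq (C D : classes) : sval C = sval D -> C = D.
Proof. by case: C D => [C hC] [D hD] /= CD; exact: eq_exist. Qed.

Lemma class_eq x y : R x y -> R x = R y.
Proof.
move=> xy; apply/funext => z; apply/propext; split=> [xz|yz].
  exact: R_trans (R_sym xy) xz.
exact: R_trans xy yz.
Qed.

Lemma class_eqR x y : R x = R y -> R x y.
Proof. by move=> ->; exact: R_refl. Qed.

Section Map.
Variable f : T -> T.
Hypotheses (f_P : forall x, P x -> P (f x))
  (f_R : forall x y, R x y -> R (f x) (f y)).

Definition class_map (C : classes) : classes := class_of (f_P (class_reprP C)).

Lemma class_mapE (C : classes) x : sval C = R x -> sval (class_map C) = R (f x).
Proof. by rewrite class_reprE => /class_eqR Cx; exact/class_eq/f_R. Qed.

End Map.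
End Classes.

Section Gr.
Variables (F : fieldType) (G : groupType) (kappa : Type).

Definition galg_bounded (A : galg F G) : Prop := [set: A] #<= [set: kappa].

Definition Gr_sort : Type := classes galg_bounded (@galg_isog F G).

Lemma iota_bounded (h : G) (A : galg F G) : galg_bounded A -> galg_bounded (iota_galg h A).
Proof. by []. Qed.

Lemma iota_isog (h : G) (A B : galg F G) : galg_isog A B -> galg_isog (iota_galg h A) (iota_galg h B).
Proof.
move=> [f [[fL fM fD] fb]]; exists f; split => //; split => // g x.
exact: fD.
Qed.

Definition Gr_act (h : G) : Gr_sort -> Gr_sort := class_map (@iota_bounded h).

Lemma Gr_actE h (C : Gr_sort) (A : galg F G) :
  sval C = galg_isog A -> sval (Gr_act h C) = galg_isog (iota_galg h A).
Proof.
apply: class_mapE; [exact: galg_isog_refl | exact: galg_isog_sym |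
  exact: galg_isog_trans | exact: iota_isog].
Qed.

Let eq_isog (A B : galg F G) : galg_isog A B -> galg_isog A = galg_isog B.
Proof. exact: class_eq (@galg_isog_sym F G) (@galg_isog_trans F G) A B. Qed.

Lemma Gr_act1 C : Gr_act 1%g C = C.
Proof.
apply: classes_eq; rewrite (Gr_actE _ (class_reprE C)) [RHS]class_reprE.
apply: eq_isog; exists id; split; last by exists id.
by split => // g x; rewrite /= invg1 mul1g mulg1.
Qed.

Lemma Gr_actM h k C : Gr_act (h * k)%g C = Gr_act h (Gr_act k C).
Proof.
apply: classes_eq; have CE := class_reprE C.
rewrite (Gr_actE _ CE) (Gr_actE _ (Gr_actE _ CE)).
apply: eq_isog; exists id; split; last by exists id.
by split => // g x; rewrite /= invgM !mulgA.
Qed.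

Lemma group_galg_iota (h : G) : galg_isog (iota_galg h (group_galg F G)) (group_galg F G).
Proof.
have UK (k : G) : (<< 1 *g k >> : group_alg F G) * << 1 *g k^-1%g >> = 1.
  by apply: etrans (grpa_mulUU _ _ _ _) _; rewrite mulr1 mulgV.
have KU (k : G) : (<< 1 *g k^-1%g >> : group_alg F G) * << 1 *g k >> = 1.
  by apply: etrans (grpa_mulUU _ _ _ _) _; rewrite mulr1 mulVg.
pose u : group_alg F G := << 1 *g h >>.
pose v : group_alg F G := << 1 *g h^-1%g >>.
exists (fun x : group_alg F G => u * x * v); split; last first.
  exists (fun x : group_alg F G => v * x * u) => x.
    by rewrite !mulrA KU mul1r -mulrA KU mulr1.
  by rewrite !mulrA UK mul1r -mulrA UK mulr1.
split.
- move=> c x y /=; rewrite mulrDr mulrDl; congr (_ + _).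
  by rewrite -pzscalerAr -pzscalerAl.
- split; first by rewrite mulr1 UK.
  by move=> x y /=; rewrite !mulrA; congr (_ * _ * _); rewrite -!mulrA KU mulr1.
- move=> g _ [c _ <-]; exists c => //; rewrite /u /v.
  apply/esym; apply: etrans (congr1 (fun x => x * _) (grpa_mulUU _ _ _ _)) _.
  apply: etrans (grpa_mulUU _ _ _ _) _.
  by rewrite mul1r mulr1 !mulgA mulgV mul1g mulgK.
Qed.

Hypothesis group_galg_bounded : galg_bounded (group_galg F G).

Definition Gr_base : Gr_sort := class_of _ group_galg_bounded.

Lemma Gr_act_base h : Gr_act h Gr_base = Gr_base.
Proof.
have baseE : sval Gr_base = galg_isog (group_galg F G) by [].
by apply: classes_eq; rewrite (Gr_actE _ baseE); exact/eq_isog/group_galg_iota.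
Qed.

(* [Gr_kappa(G, F)]                                                           *)
Definition Gr : pointedGSet G := PointedGSet Gr_act1 Gr_actM Gr_act_base.

End Gr.

Section GrMod.
Variables (F : fieldType) (G : groupType) (kappa kappa' : Type).

Definition gmod_bounded (W : gmod F G) : Prop :=
  galg_bounded kappa (gm_alg W) /\ [set: W] #<= [set: kappa'].

Definition GrMod_sort : Type := classes gmod_bounded (@gmod_eqv F G).

Lemma suspension_bounded (h : G) (W : gmod F G) : gmod_bounded W -> gmod_bounded (suspension h W).
Proof. by []. Qed.

Lemma suspension_eqv (h : G) (V W : gmod F G) :
  gmod_eqv V W -> gmod_eqv (suspension h V) (suspension h W).
Proof.
move=> [[p [f [pI fb fD fA]]]|]; last by right.
by left; exists p, f; split => // g w; exact: fD.
Qed.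

Definition GrMod_act (h : G) : GrMod_sort -> GrMod_sort :=
  class_map (@suspension_bounded h).

Lemma GrMod_actE h (C : GrMod_sort) (W : gmod F G) :
  sval C = gmod_eqv W -> sval (GrMod_act h C) = gmod_eqv (suspension h W).
Proof.
apply: class_mapE; [exact: gmod_eqv_refl | exact: gmod_eqv_sym |
  exact: gmod_eqv_trans | exact: suspension_eqv].
Qed.

Let eq_eqv (V W : gmod F G) : gmod_eqv V W -> gmod_eqv V = gmod_eqv W.
Proof. exact: class_eq (@gmod_eqv_sym F G) (@gmod_eqv_trans F G) V W. Qed.

Lemma GrMod_act1 C : GrMod_act 1%g C = C.
Proof.
apply: classes_eq; rewrite (GrMod_actE _ (class_reprE C)) [RHS]class_reprE.
apply: eq_eqv; left; exists id, id; split => //; first exact: galg_iso_id.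
  by split => //; exists id.
by move=> g w; rewrite /= mulg1.
Qed.

Lemma GrMod_actM h k C : GrMod_act (h * k)%g C = GrMod_act h (GrMod_act k C).
Proof.
apply: classes_eq; have CE := class_reprE C.
rewrite (GrMod_actE _ CE) (GrMod_actE _ (GrMod_actE _ CE)).
apply: eq_eqv; left; exists id, id; split => //; first exact: galg_iso_id.
  by split => //; exists id.
by move=> g w; rewrite /= mulgA.
Qed.

Lemma group_gmod_suspension (h : G) :
  gmod_equivariant (suspension h (group_gmod F G)) (group_gmod F G).
Proof.
pose u : group_alg F G := << 1 *g h >>.
pose v : group_alg F G := << 1 *g h^-1%g >>.
have uv : u * v = 1.
  by apply: etrans (grpa_mulUU _ _ _ _) _; rewrite mulr1 mulgV.
have vu : v * u = 1.
  by apply: etrans (grpa_mulUU _ _ _ _) _; rewrite mulr1 mulVg.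
exists id, (fun x : group_alg F G => x * v); split.
- exact: galg_iso_id.
- split; first by move=> c x y; rewrite mulrDl; congr (_ + _); rewrite -mulrA.
  by exists (fun x : group_alg F G => x * u) => x; rewrite -mulrA ?uv ?vu mulr1.
- move=> g _ [c _ <-]; exists c => //.
  by apply/esym; apply: etrans (grpa_mulUU _ _ _ _) _; rewrite mulr1 mulgK.
- by move=> x w; rewrite -[LHS]mulrA.
Qed.

Hypothesis group_galg_bounded : galg_bounded kappa (group_galg F G).
Hypothesis group_gmod_bounded : [set: group_gmod F G] #<= [set: kappa'].

Definition GrMod_base : GrMod_sort :=
  class_of _ (conj group_galg_bounded group_gmod_bounded : gmod_bounded (group_gmod F G)).

Lemma GrMod_act_base h : GrMod_act h GrMod_base = GrMod_base.
Proof.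
have baseE : sval GrMod_base = gmod_eqv (group_gmod F G) by [].
apply: classes_eq; rewrite (GrMod_actE _ baseE); apply: eq_eqv; left.
exact: group_gmod_suspension.
Qed.

(* [M_{kappa, kappa', G, F}]                                                  *)
Definition GrMod : pointedGSet G :=
  PointedGSet GrMod_act1 GrMod_actM GrMod_act_base.

End GrMod.

(* Main.v *)
Require Import Defs.
From HB Require Import structures.
From mathcomp Require Import all_boot all_algebra.
From mathcomp Require Import boolp classical_sets functions cardinality.
From mathcomp Require Import finmap.
From mathcomp.multinomials Require Import monalg.

Set Implicit Arguments.
Unset Strict Implicit.
Unset Printing Implicit Defensive.

Import GRing.Theory.
Local Open Scope ring_scope.

Local Open Scope classical_set_scope.
Local Open Scope card_scope.

(** The graded endomorphism algebra of [W] depends on the algebra [A] acting on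
    [W] only through the image of [A] in the [F]-linear endomorphisms of [W].
    A linear bijection [phi : V -> W] that identifies the two images therefore
    conjugates the endomorphisms of [V] into those of [W]. Gradings are
    followed at the same time: let [phi] map [V_g] onto [W_{gh}], and let [f]
    have right degree [g]. Then [phi o f o phi^-1] sends
    [W_l -> V_{l h^-1} -> V_{l h^-1 g} -> W_{l h^-1 g h}],
    so it has right degree [h^-1 g h], and conjugation is a graded isomorphism
    from [End V] to [iota_h (End W)] ([endr_similarity]).

    Two instances give most of the theorem. With [h = 1], equivariant modules
    have isomorphic endomorphism algebras; so do two zero modules over
    arbitrary algebras, because both algebras act through the zero ring
    ([endr_eqv]). With [phi] the identity from the suspension [h W] to [W],
    one gets [End (h W) ~ iota_h (End W)], which is equivariance
    ([endr_suspension]).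

    For the base points, an endomorphism of the regular module [FG] is right
    multiplication by its value at [1], and writing endomorphisms on the right
    makes [f |-> f 1] multiplicative rather than antimultiplicative
    ([endr_group_gmod]).

    Finally the values of the map lie in [Gr_kappa]: endomorphisms of [W] are
    maps [W -> W], and these embed into the maps [kappa' -> kappa']
    ([endr_bounded]). *)

Section Similarity.
Variables (F : fieldType) (G : groupType).
Implicit Types U V W : gmod F G.

(** [phi] is a linear bijection of degree [h] under which the two algebras have
    the same image in the linear endomorphisms. The conditions do not speak of
    a map between the algebras, so that zero modules over non-isomorphic
    algebras, which form a single class, are covered too. *)
Record similarity (h : G) V W (phi : V -> W) (phi' : W -> V) : Prop :=
  Similarity {
    sim_linear : linear (phi : res_scalars V -> res_scalars W);
    simK : cancel phi phi';
    simVK : cancel phi' phi;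
    sim_deg : forall g v, gm_comp V g v -> gm_comp W (g * h)%g (phi v);
    sim_act : forall a : gm_alg V, exists b : gm_alg W,
      forall v, phi (a *: v) = b *: phi v;
    simV_act : forall b : gm_alg W, exists a : gm_alg V,
      forall v, phi (a *: v) = b *: phi v }.

(** That [phi'] has degree [h^-1] is not part of the definition: it holds since
    an injective map of degree [h] into a graded module reflects degrees. *)
Lemma similarity_sym h V W (phi : V -> W) (phi' : W -> V) :
  similarity h phi phi' -> similarity h^-1%g phi' phi.
Proof.
move=> [phiL phiK phi'K phiD phiA phiA']; split => //.
- exact: (@can_linear _ (res_scalars V) (res_scalars W) _ _ phiL phiK phi'K).
- move=> g w Ww.
  apply: (@grading_reflect _ _ (res_scalars V) (res_scalars W) _ _ phi
    (gm_grading V) (gm_grading (suspension h W)) phiL (can_inj phiK) phiD).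
  by rewrite phi'K /= mulgVK.
- move=> b; have [a aP] := phiA' b; exists a => w.
  by apply: (can_inj phiK); rewrite aP !phi'K.
- move=> a; have [b bP] := phiA a; exists b => w.
  by apply: (can_inj phiK); rewrite bP !phi'K.
Qed.

Lemma equivariant_similarity V W : gmod_equivariant V W ->
  exists (phi : V -> W) phi', similarity 1%g phi phi'.
Proof.
move=> [psi [phi [[_ [psi' psiK psi'K]] [phiL [phi' phiK phi'K]] phiD phiA]]].
exists phi, phi'; split => //.
- by move=> g v; rewrite mulg1; exact: phiD.
- by move=> a; exists (psi a) => v; exact: phiA.
- by move=> b; exists (psi' b) => v; rewrite phiA psi'K.
Qed.

Lemma zero_similarity V W : gmod_zero V -> gmod_zero W ->
  similarity 1%g (fun=> 0 : W) (fun=> 0 : V).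
Proof.
move=> V0 W0; split.
- by move=> c x y; rewrite scaler0 addr0.
- by move=> v; rewrite [RHS]V0.
- by move=> w; rewrite [RHS]W0.
- by move=> g v _; exact: (grading0 (gm_grading W)).
- by move=> a; exists 0 => v; rewrite scaler0.
- by move=> b; exists 0 => v; rewrite scaler0.
Qed.

Lemma eqv_similarity V W : gmod_eqv V W ->
  exists (phi : V -> W) phi', similarity 1%g phi phi'.
Proof.
case=> [/equivariant_similarity//|[V0 W0]].
by exists (fun=> 0), (fun=> 0); exact: zero_similarity.
Qed.

Lemma suspension_similarity h W :
  @similarity h (suspension h W) W id id.
Proof. by split => // a; exists a. Qed.

Section Conjugation.
Variables (h : G) (V W : gmod F G) (phi : V -> W) (phi' : W -> V).
Hypothesis simP : similarity h phi phi'.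

Let phi0 : phi 0 = 0.
Proof.
by have := sim_linear simP (-1) 0 0; rewrite scaler0 addr0 scaleN1r addNr.
Qed.

Let phiD x y : phi (x + y) = phi x + phi y.
Proof. by have := sim_linear simP 1 x y; rewrite !scale1r. Qed.

(** This is where the hypothesis on the images of the algebras enters: to pull
    [b] out of [phi'], replace it by an element of the other algebra that acts
    on [V] as [b] does on [W]. *)
Lemma conj_linear (f : V -> V) : linear f -> linear (phi \o f \o phi').
Proof.
move=> fL b w w' /=; have [a aP] := simV_act simP b.
have -> : phi' (b *: w + w') = a *: phi' w + phi' w'.
  by apply: (can_inj (simK simP)); rewrite phiD aP !(simVK simP).
by rewrite fL phiD aP.
Qed.

Lemma conj_hom g (f : V -> V) :
  end_hom g f -> end_hom (h^-1 * g * h)%g (phi \o f \o phi').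
Proof.
move=> [fL fD]; split; first exact: conj_linear.
move=> k w Ww; rewrite !mulgA; apply/(sim_deg simP)/fD.
exact: (sim_deg (similarity_sym simP)).
Qed.

Lemma conj_mem (f : V -> res_scalars V) :
  f \in @end_mem F G V ->
  (phi \o f \o phi' : W -> res_scalars W) \in @end_mem F G W.
Proof.
move=> /end_memP[s [u [uH ->]]].
have -> : phi \o (\sum_(g <- s) u g) \o phi'
    = \sum_(g <- s) (phi \o u g \o phi' : W -> res_scalars W).
  apply/funext => w /=; rewrite !fct_sumE.
  exact: (big_morph phi phiD phi0).
by apply: rpred_sum => g _; apply: end_mem_hom; exact: conj_hom (uH g).
Qed.

Definition conj_endr (f : endr V) : endr W := EndR (conj_mem (endr_prop f)).

End Conjugation.

Lemma endr_similarity h V W (phi : V -> W) (phi' : W -> V) :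
  similarity h phi phi' ->
  galg_isog (endr_galg V) (iota_galg h (endr_galg W)).
Proof.
move=> simP; have [phiL phiK phi'K _ _ _] := simP.
exists (conj_endr simP); split; last first.
  exists (conj_endr (similarity_sym simP)) => f; apply: endr_ext => w /=.
    by rewrite !phiK.
  by rewrite !phi'K.
split.
- by move=> c f k; apply: endr_ext => w; exact: phiL.
- split; first by apply: endr_ext => w /=; rewrite phi'K.
  by move=> f k; apply: endr_ext => w /=; rewrite phiK.
- by move=> g f; exact: conj_hom.
Qed.

Lemma iota_galg1 (A : galg F G) : galg_isog (iota_galg 1%g A) A.
Proof.
exists id; split; last by exists id.
by split => // g x; rewrite /= invg1 mul1g mulg1.
Qed.

Lemma endr_eqv V W :
  gmod_eqv V W -> galg_isog (endr_galg V) (endr_galg W).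
Proof.
move=> /eqv_similarity[phi [phi' /endr_similarity VW]].
exact: galg_isog_trans VW (iota_galg1 _).
Qed.

Lemma endr_suspension h W :
  galg_isog (endr_galg (suspension h W)) (iota_galg h (endr_galg W)).
Proof. exact: endr_similarity (suspension_similarity h W). Qed.

End Similarity.

Section GroupAlgebraEndomorphisms.
Variables (F : fieldType) (G : groupType).

Let FG : gmod F G := group_gmod F G.

Lemma grpa_rmul_hom (c : F) (g : G) :
  @end_hom F G FG g (fun w : group_alg F G => w * << c *g g >>).
Proof.
split; first by move=> a v w; rewrite mulrDl; congr (_ + _); rewrite -mulrA.
by move=> k w Ww; apply: grpa_homM => //; exists c.
Qed.

Lemma grpa_rmul_mem (x : group_alg F G) :
  ((fun w : group_alg F G => w * x) : FG -> res_scalars FG) \in @end_mem F G FG.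
Proof.
apply/end_memP; exists (msupp x), (fun g (w : group_alg F G) => w * << x@_g *g g >>).
split; first by move=> g; exact: grpa_rmul_hom.
apply/funext => w; rewrite fct_sumE [in LHS](monalgE x).
exact: (mulr_sumr _ _ _ w).
Qed.

Definition grpa_rmul (x : group_alg F G) : endr FG := EndR (grpa_rmul_mem x).

(** [f x = f (x 1) = x (f 1)], since [f] commutes with left multiplications. *)
Lemma endr_grpaE (f : endr FG) (x : group_alg F G) :
  f x = x * (f (1 : group_alg F G) : group_alg F G).
Proof.
have /(_ x 1 0) := endr_linear f.
rewrite !addr0 endr0 addr0; apply: etrans; congr (f _).
by apply/esym; exact: mulr1.
Qed.

(** Degrees agree because [1] has degree [1]: an endomorphism of right degree
    [g] sends it into degree [1 g = g]. *)
Lemma endr_group_gmod : galg_isog (endr_galg FG) (group_galg F G).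
Proof.
exists (fun f : endr FG => f (1 : group_alg F G) : group_alg F G).
split; last first.
  exists grpa_rmul => [f|x]; last exact: mul1r.
  by apply: endr_ext => x; rewrite [RHS]endr_grpaE.
split.
- move=> c f k.
  (* On the module side [c] acts as the element [c *: 1] of [FG], on the
     algebra side it scales coefficients. *)
  have scaleE (x : group_alg F G) : c *: (1 : group_alg F G) * x = c *: x.
    by rewrite -pzscalerAl mul1r.
  exact: (congr1 (fun x : group_alg F G => x + k (1 : group_alg F G))
    (scaleE (f (1 : group_alg F G)))).
- split; first by [].
  by move=> f k; rewrite -endr_grpaE.
- move=> g f [_ /(_ 1%g 1)]; rewrite mul1g; apply.
  by exists 1.
Qed.

End GroupAlgebraEndomorphisms.

(** Unlike [pcard_injP], this covers an empty or unpointed [U], such as an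
    arbitrary cardinal bound. *)
Lemma card_setT_leP (T U : Type) :
  [set: T] #<= [set: U] <-> exists f : T -> U, injective f.
Proof.
split=> [/card_leP[f]|[f fI]].
  exists (fun x => val (f (to_setT x))) => x y /val_inj fxy.
  have /(congr1 val) // : to_setT x = to_setT y.
  by apply: (@inj _ _ setT f) => //; exact: in_setT.
apply: card_le_trans (subset_card_le (@subsetT _ (f @` [set: T]))).
have fTE : f @` [set: T] #= [set: T] by apply: inj_card_eq => x y _ _; exact: fI.
by case/card_eqPle: fTE.
Qed.

(** An injection [i : W -> kappa'] has a left inverse [j], as [W] contains [0];
    then [f |-> i o f o j] is injective, because [f] is recovered as
    [j o (i o f o j) o i]. *)
Lemma endr_bounded (F : fieldType) (G : groupType) (kappa kappa' : Type)
    (W : gmod F G) :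
  [set: kappa' -> kappa'] #<= [set: kappa] -> [set: W] #<= [set: kappa'] ->
  galg_bounded kappa (endr_galg W).
Proof.
move=> large /card_setT_leP[i iI]; apply: card_le_trans large.
have [j jK] : exists j : kappa' -> W, cancel i j.
  exists (fun y => if pselect (exists w, i w = y) is left e then sval (cid e) else 0).
  move=> w; case: pselect => [e|[]]; last by exists w.
  by apply: iI; exact: svalP (cid e).
apply/card_setT_leP; exists (fun f : endr W => i \o f \o j).
move=> f k fk; apply: endr_ext => w; apply: iI.
by have := congr1 (fun u => u (i w)) fk; rewrite /= jK.
Qed.

Theorem corollary5p6 (F : fieldType) (G : groupType) (kappa kappa' : Type)
    (kappa_inf : infinite_set [set: kappa])
    (kappa'_inf : infinite_set [set: kappa'])
    (FG_in_Gr : galg_bounded kappa (group_galg F G))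
    (FG_in_GrMod : [set: group_gmod F G] #<= [set: kappa'])
    (kappa_large : [set: kappa' -> kappa'] #<= [set: kappa]) :
  exists End : GrMod FG_in_Gr FG_in_GrMod -> Gr FG_in_Gr,
    (forall (C : GrMod FG_in_Gr FG_in_GrMod) (W : gmod F G),
       sval C = gmod_eqv W -> sval (End C) = galg_isog (endr_galg W)) /\
    pgs_morphism End.
Proof.
have isogE (A B : galg F G) : galg_isog A B -> galg_isog A = galg_isog B.
  exact: class_eq (@galg_isog_sym F G) (@galg_isog_trans F G) A B.
pose End (C : GrMod_sort F G kappa kappa') : Gr_sort F G kappa :=
  class_of _ (endr_bounded kappa_large (proj2 (class_reprP C))).
have EndE C W : sval C = gmod_eqv W -> sval (End C) = galg_isog (endr_galg W).
  rewrite class_reprE => /(class_eqR (@gmod_eqv_refl F G)) CW.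
  exact/isogE/endr_eqv.
exists End; split=> //; split.
- move=> h C; apply: classes_eq; have CE := class_reprE C.
  rewrite (EndE _ _ (GrMod_actE h CE)) (Gr_actE h (EndE _ _ CE)).
  exact/isogE/endr_suspension.
- apply: classes_eq; rewrite (EndE (GrMod_base FG_in_Gr FG_in_GrMod) _ erefl).
  exact/isogE/endr_group_gmod.
Qed.
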